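(* Let $B$ be a finite set (alphabet). The $B$-ary magma monad $\mathsf T_B$ on the category $\mathbf{Set}$ of sets is linear exponential with respect to the symmetric monoidal structure $(\odot,0)$ on $\mathbf{Set}$; that is, $\mathsf T_B$ admits a symmetric opmonoidal structure with respect to $(\odot,0)$ for which the lifted symmetric monoidal structure on the category of $\mathsf T_B$-algebras is given by finite coproducts.
   Context: A $B$-ary magma is a set $X$ with a function $X^B\to X$. $\mathsf T_B$ is the free $B$-ary magma monad: $T_B(A)=\mu X.\,(X^B+A)$ is the set of well-founded $B$-ary branching trees with leaves labelled in $A$; the unit sends $a$ to the one-vertex tree labelled $a$, and the multiplication grafts trees at leaves. Its algebras are $B$-ary magmas. For $A'\subseteq A$, a tree in $T_B(A)$ is $A'$-labelled if all its leaves have labels in $A'$, i.e. it lies in $T_B(A')\subseteq T_B(A)$; it is trivial if it consists of a single labelled leaf; a subtree is the tree above (rooted at) some vertex. The monoidal structure $(\odot,0)$ has unit the empty set and tensor $$X\odot Y=\{\tau\in T_B(X+Y):\tau\text{ has no non-trivial }X\text{-labelled or }Y\text{-labelled subtree}\},$$ with $f\odot g$ given by relabelling leaves. Similarly $X\odot Y\odot Z\subseteq T_B(X+Y+Z)$ consists of the trees with no non-trivial $X$-, $Y$- or $Z$-labelled subtree. There are bijections $(X\odot Y)\odot Z\xrightarrow{\ell}X\odot Y\odot Z\xleftarrow{r}X\odot(Y\odot Z)$, where $\ell$ replaces each leaf labelled by an element of $X\odot Y$ by that $(X+Y)$-labelled tree, and $r$ is defined dually; the associativity constraint is $r^{-1}\circ\ell$.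 The unit constraints $X\odot0\cong X\cong0\odot X$ are the evident ones, and the symmetry is relabelling along $X+Y\cong Y+X$. A symmetric opmonoidal structure on a monad $\mathsf T=(T,\eta,\mu)$ on a symmetric monoidal category $(\mathcal C,\otimes,I)$ consists of a map $\upsilon_I\colon TI\to I$ and natural maps $\upsilon_{XY}\colon T(X\otimes Y)\to TX\otimes TY$ making $T$ a symmetric opmonoidal (colax monoidal) functor and $\eta,\mu$ opmonoidal transformations. It lifts the symmetric monoidal structure of $\mathcal C$ to the category $\mathcal C^{\mathsf T}$ of Eilenberg--Moore algebras: $(X,x)\otimes(Y,y)=(X\otimes Y,(x\otimes y)\circ\upsilon_{XY})$, with unit $(I,\upsilon_I)$ and constraints those of $\mathcal C$. (Such structures correspond bijectively to symmetric monoidal structures on $\mathcal C^{\mathsf T}$ for which the forgetful functor is strict symmetric monoidal.) A linear exponential monad is a symmetric opmonoidal monad for which $(I,\upsilon_I)$ is initial in $\mathcal C^{\mathsf T}$ and, for all algebras $(X,x),(Y,y)$, the cospan $(X,x)\cong(X,x)\otimes(I,\upsilon_I)\xrightarrow{1\otimes !}(X,x)\otimes(Y,y)\xleftarrow{!\otimes 1}(I,\upsilon_I)\otimes(Y,y)\cong(Y,y)$ is a coproduct in $\mathcal C^{\mathsf T}$, where $!$ denotes the unique maps out of the initial algebra.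
   Formalization: The alphabet B is assumed non-empty: for empty B one has T_B(0) = 1, so there is no map T_B(0) → 0 and hence no opmonoidal structure with respect to (⊙, 0), and the claim fails. *)

(* Defs.v *)
From mathcomp Require Import all_boot.
From mathcomp Require Import boolp classical_sets.

Set Implicit Arguments.
Unset Strict Implicit.
Unset Printing Implicit Defensive.

Declare Scope cat_scope.
Local Open Scope cat_scope.

Record category := Category {
  obj :> Type;
  hom : obj -> obj -> Type;
  idm : forall X, hom X X;
  comp : forall X Y Z, hom Y Z -> hom X Y -> hom X Z;
  comp1m : forall X Y (f : hom X Y), comp (idm Y) f = f;
  compm1 : forall X Y (f : hom X Y), comp f (idm X) = f;
  compA : forall X Y Z W (h : hom Z W) (g : hom Y Z) (f : hom X Y),
    comp h (comp g f) = comp (comp h g) f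
}.
Arguments idm {_} X.
Notation "g \oc f" := (comp g f) (at level 40, left associativity) : cat_scope.

Record initial (C : category) (I : C) := Initial {
  bang : forall X : C, hom I X;
  bangP : forall (X : C) (f : hom I X), f = bang X
}.

Definition is_coproduct (C : category) (X Y S : C) (i : hom X S) (j : hom Y S) :
    Prop :=
  forall (W : C) (f : hom X W) (g : hom Y W),
    exists! h : hom S W, h \oc i = f /\ h \oc j = g.

Record symmon := SymMon {
  smcat :> category;
  ten : smcat -> smcat -> smcat;
  tenm : forall X X' Y Y',
    hom X X' -> hom Y Y' -> hom (ten X Y) (ten X' Y');
  tunit : smcat;
  assoc : forall X Y Z, hom (ten (ten X Y) Z) (ten X (ten Y Z));
  associ : forall X Y Z, hom (ten X (ten Y Z)) (ten (ten X Y) Z);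
  lunit : forall X, hom (ten tunit X) X;
  luniti : forall X, hom X (ten tunit X);
  runit : forall X, hom (ten X tunit) X;
  runiti : forall X, hom X (ten X tunit);
  symm : forall X Y, hom (ten X Y) (ten Y X);
  tenm1 : forall X Y, tenm (idm X) (idm Y) = idm (ten X Y);
  tenmM : forall X X' X'' Y Y' Y'' (f' : hom X' X'') (f : hom X X')
    (g' : hom Y' Y'') (g : hom Y Y'),
    tenm (f' \oc f) (g' \oc g) = tenm f' g' \oc tenm f g;
  assocK : forall X Y Z, associ X Y Z \oc assoc X Y Z = idm _;
  associK : forall X Y Z, assoc X Y Z \oc associ X Y Z = idm _;
  lunitK : forall X, luniti X \oc lunit X = idm _;
  lunitiK : forall X, lunit X \oc luniti X = idm _;
  runitK : forall X, runiti X \oc runit X = idm _;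
  runitiK : forall X, runit X \oc runiti X = idm _;
  symmK : forall X Y, symm Y X \oc symm X Y = idm _;
  assoc_nat : forall X X' Y Y' Z Z' (f : hom X X') (g : hom Y Y') (h : hom Z Z'),
    assoc X' Y' Z' \oc tenm (tenm f g) h = tenm f (tenm g h) \oc assoc X Y Z;
  lunit_nat : forall X X' (f : hom X X'),
    lunit X' \oc tenm (idm tunit) f = f \oc lunit X;
  runit_nat : forall X X' (f : hom X X'),
    runit X' \oc tenm f (idm tunit) = f \oc runit X;
  symm_nat : forall X X' Y Y' (f : hom X X') (g : hom Y Y'),
    symm X' Y' \oc tenm f g = tenm g f \oc symm X Y;
  triangle : forall X Y,
    tenm (idm X) (lunit Y) \oc assoc X tunit Y = tenm (runit X) (idm Y);
  pentagon : forall W X Y Z,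
    tenm (idm W) (assoc X Y Z) \oc assoc W (ten X Y) Z
      \oc tenm (assoc W X Y) (idm Z)
    = assoc W X (ten Y Z) \oc assoc (ten W X) Y Z;
  hexagon : forall X Y Z,
    assoc Y Z X \oc symm X (ten Y Z) \oc assoc X Y Z
    = tenm (idm Y) (symm X Z) \oc assoc Y X Z \oc tenm (symm X Y) (idm Z)
}.
Arguments tunit {_}.

(* The tensor product of X and Y is a coproduct whose injections are built from the
   unique maps out of the unit, required to be initial. *)
Definition cocartesian (D : symmon) : Prop :=
  exists ini : initial (tunit : D), forall X Y : D,
    is_coproduct (tenm (idm X) (bang ini Y) \oc runiti X)
                 (tenm (bang ini X) (idm Y) \oc luniti Y).

Record monad (C : category) := Monad {
  mobj :> C -> C;
  mmap : forall X Y, hom X Y -> hom (mobj X) (mobj Y);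
  munit : forall X, hom X (mobj X);
  mmul : forall X, hom (mobj (mobj X)) (mobj X);
  mmap1 : forall X, mmap (idm X) = idm (mobj X);
  mmapM : forall X Y Z (g : hom Y Z) (f : hom X Y),
    mmap (g \oc f) = mmap g \oc mmap f;
  munit_nat : forall X Y (f : hom X Y), mmap f \oc munit X = munit Y \oc f;
  mmul_nat : forall X Y (f : hom X Y),
    mmap f \oc mmul X = mmul Y \oc mmap (mmap f);
  mmul_unitl : forall X, mmul X \oc munit (mobj X) = idm _;
  mmul_unitr : forall X, mmul X \oc mmap (munit X) = idm _;
  mmulA : forall X, mmul X \oc mmul (mobj X) = mmul X \oc mmap (mmul X)
}.

Section Algebras.
Variables (C : category) (T : monad C).

Record algebra := Algebra {
  acar :> C;
  aact : hom (T acar) acar;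
  aact_unit : aact \oc munit T acar = idm acar;
  aact_mul : aact \oc mmul T acar = aact \oc mmap T aact
}.

Record alg_hom (X Y : algebra) := AlgHom {
  amap : hom X Y;
  amapP : amap \oc aact X = aact Y \oc mmap T amap
}.

Lemma alg_hom_eq (X Y : algebra) (f g : alg_hom X Y) : amap f = amap g -> f = g.
Proof.
case: f g => [f fP] [g gP] /= e; rewrite -{}e in gP *.
by rewrite (Prop_irrelevance fP gP).
Qed.

Definition alg_id (X : algebra) : alg_hom X X.
Proof.
by exists (idm X); rewrite mmap1 comp1m compm1.
Defined.

Definition alg_comp (X Y Z : algebra) (g : alg_hom Y Z) (f : alg_hom X Y) :
  alg_hom X Z.
Proof.
exists (amap g \oc amap f).
by rewrite mmapM -compA amapP compA amapP compA.
Defined.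

Definition em_cat : category.
Proof.
apply: (@Category algebra alg_hom alg_id alg_comp) => *; apply: alg_hom_eq => /=.
- exact: comp1m.
- exact: compm1.
- exact: compA.
Defined.

End Algebras.

Record symopmon (C : symmon) (T : monad C) := SymOpmon {
  ups0 : hom (T tunit) tunit;
  ups : forall X Y, hom (T (ten X Y)) (ten (T X) (T Y));
  ups_nat : forall X X' Y Y' (f : hom X X') (g : hom Y Y'),
    ups X' Y' \oc mmap T (tenm f g) = tenm (mmap T f) (mmap T g) \oc ups X Y;
  ups_assoc : forall X Y Z,
    assoc (T X) (T Y) (T Z) \oc tenm (ups X Y) (idm (T Z)) \oc ups (ten X Y) Z
    = tenm (idm (T X)) (ups Y Z) \oc ups X (ten Y Z) \oc mmap T (assoc X Y Z);
  ups_lunit : forall X,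
    lunit (T X) \oc tenm ups0 (idm (T X)) \oc ups tunit X = mmap T (lunit X);
  ups_runit : forall X,
    runit (T X) \oc tenm (idm (T X)) ups0 \oc ups X tunit = mmap T (runit X);
  ups_symm : forall X Y,
    symm (T X) (T Y) \oc ups X Y = ups Y X \oc mmap T (symm X Y);
  ups_munit : forall X Y,
    ups X Y \oc munit T (ten X Y) = tenm (munit T X) (munit T Y);
  ups_mmul : forall X Y,
    ups X Y \oc mmul T (ten X Y)
    = tenm (mmul T X) (mmul T Y) \oc ups (T X) (T Y) \oc mmap T (ups X Y);
  ups0_munit : ups0 \oc munit T tunit = idm tunit;
  ups0_mmul : ups0 \oc mmul T tunit = ups0 \oc mmap T ups0
}.
Arguments symopmon : clear implicits.

Section Lifting.
Variables (C : symmon) (T : monad C) (u : symopmon C T).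

Lemma tenmMl (X X' X'' Y Y' : C) (f' : hom X' X'') (f : hom X X')
    (g : hom Y Y') :
  tenm f' (idm Y') \oc tenm f g = tenm (f' \oc f) g.
Proof. by rewrite -tenmM comp1m. Qed.

Definition alg_ten (X Y : algebra T) : algebra T.
Proof.
exists (ten X Y) (tenm (aact X) (aact Y) \oc ups u X Y).
- by rewrite -compA ups_munit -tenmM !aact_unit tenm1.
- rewrite -compA ups_mmul !compA -tenmM !aact_mul tenmM mmapM -!compA.
  by congr (_ \oc _); rewrite !compA ups_nat.
Defined.

Definition alg_tunit : algebra T.
Proof.
exists tunit (ups0 u); [exact: ups0_munit | exact: ups0_mmul].
Defined.

Definition alg_tenm (X X' Y Y' : algebra T) (f : alg_hom X X')
  (g : alg_hom Y Y') : alg_hom (alg_ten X Y) (alg_ten X' Y').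
Proof.
exists (tenm (amap f) (amap g)) => /=.
by rewrite compA -tenmM !amapP tenmM -!compA ups_nat.
Defined.

Lemma inv_amapP (X Y : algebra T) (f : hom X Y) (g : hom Y X) :
  f \oc g = idm Y -> g \oc f = idm X ->
  f \oc aact X = aact Y \oc mmap T f ->
  g \oc aact Y = aact X \oc mmap T g.
Proof.
move=> fg gf fP.
rewrite -[aact Y]compm1 -mmap1 -fg mmapM [aact Y \oc _]compA -fP.
by rewrite !compA gf comp1m.
Qed.

Definition alg_assoc (X Y Z : algebra T) :
  alg_hom (alg_ten (alg_ten X Y) Z) (alg_ten X (alg_ten Y Z)).
Proof.
exists (assoc X Y Z) => /=.
rewrite -{1}(compm1 (aact Z)) -{2}(compm1 (aact X)) !tenmM.
by rewrite !compA assoc_nat -!compA; congr (_ \oc _); rewrite !compA ups_assoc.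
Defined.

Definition alg_associ (X Y Z : algebra T) :
  alg_hom (alg_ten X (alg_ten Y Z)) (alg_ten (alg_ten X Y) Z).
Proof.
exists (associ X Y Z).
apply: inv_amapP (amapP (alg_assoc X Y Z)); [exact: associK | exact: assocK].
Defined.

Definition alg_lunit (X : algebra T) : alg_hom (alg_ten alg_tunit X) X.
Proof.
exists (lunit X) => /=.
rewrite -[ups0 u]comp1m -{1}(compm1 (aact X)) tenmM.
by rewrite !compA lunit_nat -(ups_lunit u) !compA.
Defined.

Definition alg_luniti (X : algebra T) : alg_hom X (alg_ten alg_tunit X).
Proof.
exists (luniti X).
apply: inv_amapP (amapP (alg_lunit X)); [exact: lunitiK | exact: lunitK].
Defined.

Definition alg_runit (X : algebra T) : alg_hom (alg_ten X alg_tunit) X.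
Proof.
exists (runit X) => /=.
rewrite -[ups0 u]comp1m -{1}(compm1 (aact X)) tenmM.
by rewrite !compA runit_nat -(ups_runit u) !compA.
Defined.

Definition alg_runiti (X : algebra T) : alg_hom X (alg_ten X alg_tunit).
Proof.
exists (runiti X).
apply: inv_amapP (amapP (alg_runit X)); [exact: runitiK | exact: runitK].
Defined.

Definition alg_symm (X Y : algebra T) : alg_hom (alg_ten X Y) (alg_ten Y X).
Proof.
exists (symm X Y) => /=.
by rewrite compA symm_nat -!compA ups_symm.
Defined.

Definition em_symmon : symmon.
Proof.
apply: (@SymMon (em_cat T) alg_ten alg_tenm alg_tunit alg_assoc alg_associ
  alg_lunit alg_luniti alg_runit alg_runiti alg_symm) => *;
  apply: alg_hom_eq => /=.
- exact: tenm1.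
- exact: tenmM.
- exact: assocK.
- exact: associK.
- exact: lunitK.
- exact: lunitiK.
- exact: runitK.
- exact: runitiK.
- exact: symmK.
- exact: assoc_nat.
- exact: lunit_nat.
- exact: runit_nat.
- exact: symm_nat.
- exact: triangle.
- exact: pentagon.
- exact: hexagon.
Defined.

Definition linear_exponential : Prop := cocartesian em_symmon.

End Lifting.

(* Objects are the types of a fixed universe, with Leibniz equality; maps are
   functions, equal when pointwise equal by functional extensionality. *)
Definition set_cat : category.
Proof.
by apply: (@Category Type (fun X Y => X -> Y) (fun X x => x)
  (fun X Y Z g f x => g (f x))).
Defined.

Section Trees.
Variable B : Type.

Inductive tree (A : Type) : Type := Leaf of A | Node of (B -> tree A).

Fixpoint tbind (A C : Type) (f : A -> tree C) (t : tree A) : tree C :=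
  match t with Leaf a => f a | Node k => Node (fun b => tbind f (k b)) end.

Definition tmap (A C : Type) (f : A -> C) : tree A -> tree C :=
  tbind (fun a => Leaf (f a)).

Lemma eq_tbind (A C : Type) (f g : A -> tree C) : f =1 g -> tbind f =1 tbind g.
Proof.
move=> fg; elim=> [a|k IH] /=; first exact: fg.
by congr Node; apply: funext.
Qed.

Lemma tbind_leaf (A : Type) (t : tree A) : tbind (@Leaf A) t = t.
Proof. by elim: t => [//|k IH] /=; congr Node; apply: funext. Qed.

Lemma tbindA (A C D : Type) (g : C -> tree D) (f : A -> tree C) (t : tree A) :
  tbind g (tbind f t) = tbind (fun a => tbind g (f a)) t.
Proof. by elim: t => [//|k IH] /=; congr Node; apply: funext. Qed.

Definition magma_monad : monad set_cat.
Proof.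
apply: (@Monad set_cat tree tmap Leaf (fun X => tbind (fun t => t))) => //=.
- by move=> X; apply: funext; apply: tbind_leaf.
- by move=> X Y Z g f; apply: funext => t; rewrite /tmap tbindA.
- by move=> X Y f; apply: funext => t; rewrite /tmap !tbindA.
- by move=> X; apply: funext => t; rewrite /tmap tbindA tbind_leaf.
- by move=> X; apply: funext => t; rewrite /tmap !tbindA.
Defined.

Inductive subtree (A : Type) : tree A -> tree A -> Prop :=
| subtree_refl t : subtree t t
| subtree_node s k b : subtree s (k b) -> subtree s (Node k).

Fixpoint labelled (A : Type) (A' : set A) (t : tree A) : Prop :=
  match t with Leaf a => A' a | Node k => forall b, labelled A' (k b) end.

Definition trivial (A : Type) (t : tree A) : Prop := exists a, t = Leaf a.

(* Equivalently, there is no non-trivial A'-labelled subtree. A tree without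
   leaves is A'-labelled for every A'. *)
Definition avoids (A : Type) (A' : set A) (t : tree A) : Prop :=
  forall s, subtree s t -> labelled A' s -> trivial s.

(* [inl] and [inr] are injective, so [range inl] is the copy of X in X + Y. *)
Definition odot (X Y : Type) : Type :=
  {t : tree (X + Y) | avoids (range inl) t /\ avoids (range inr) t}.

Definition Odot (X Y : Type) (t : tree (X + Y)) (tl : avoids (range inl) t)
  (tr : avoids (range inr) t) : odot X Y := exist _ t (conj tl tr).

Definition odot3 (X Y Z : Type) : Type :=
  {t : tree (X + Y + Z) | [/\ avoids (range (inl \o inl)) t,
     avoids (range (inl \o inr)) t & avoids (range inr) t]}.

Definition Odot3 (X Y Z : Type) (t : tree (X + Y + Z))
  (t1 : avoids (range (inl \o inl)) t) (t2 : avoids (range (inl \o inr)) t)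
  (t3 : avoids (range inr) t) : odot3 X Y Z := exist _ t (And3 t1 t2 t3).

Lemma odot_eq (X Y : Type) (s t : odot X Y) : sval s = sval t -> s = t.
Proof. by case: s t => [s ps] [t pt] /= e; apply: eq_exist. Qed.

Lemma odot3_eq (X Y Z : Type) (s t : odot3 X Y Z) : sval s = sval t -> s = t.
Proof. by case: s t => [s ps] [t pt] /= e; apply: eq_exist. Qed.

Lemma subtree_leaf (A : Type) (s : tree A) a : subtree s (Leaf a) -> s = Leaf a.
Proof. by move=> H; inversion H. Qed.

Lemma avoids_leaf (A : Type) (A' : set A) a : avoids A' (Leaf a).
Proof. by move=> s sa _; exists a; apply: subtree_leaf. Qed.

Lemma subtree_trans (A : Type) (s t u : tree A) :
  subtree s t -> subtree t u -> subtree s u.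
Proof. by move=> st tu; elim: tu st => // s' k b _ IH /IH; apply: subtree_node. Qed.

Lemma avoids_sub (A : Type) (A' : set A) (s t : tree A) :
  subtree s t -> avoids A' t -> avoids A' s.
Proof. by move=> st At r rs; apply: At; apply: subtree_trans st. Qed.

Lemma avoids_child (A : Type) (A' : set A) k b :
  avoids A' (Node k) -> avoids (A := A) A' (k b).
Proof. by apply: avoids_sub; apply: (subtree_node (b := b)); constructor. Qed.

Lemma avoids_node (A : Type) (A' : set A) k :
  (forall b, avoids A' (k b)) -> ~ labelled A' (Node k) -> avoids A' (Node k).
Proof.
move=> Ak nl s sk L; inversion sk; subst; first by [].
by apply: Ak L; eassumption.
Qed.

Lemma labelled_bind (A C : Type) (f : A -> tree C) (C' : set C) t :
  labelled C' (tbind f t) <-> labelled (fun a => labelled C' (f a)) t.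
Proof.
by elim: t => [//|k IH] /=; split=> H b; apply/IH.
Qed.

Lemma labelled_mono (A : Type) (P Q : set A) t :
  (forall a, P a -> Q a) -> labelled P t -> labelled Q t.
Proof.
move=> PQ; elim: t => [a|k IH] /=; first exact: PQ.
by move=> H b; apply: IH.
Qed.

Lemma labelledI (A : Type) (P Q : set A) t :
  labelled P t -> labelled Q t -> labelled (fun a => P a /\ Q a) t.
Proof. by elim: t => [//|k IH] /= H1 H2 b; apply: IH. Qed.

Lemma subtree_bind (A C : Type) (f : A -> tree C) t s :
  subtree s (tbind f t) ->
  (exists2 t', subtree t' t & s = tbind f t') \/
  (exists2 a, subtree (Leaf a) t & subtree s (f a)).
Proof.
elim: t => [a|k IH] /= H; first by right; exists a => //; constructor.
inversion H; subst; first by left; exists (Node k) => //; constructor.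
case: (IH _ H2) => [[t' t'k ->]|[a ak sa]].
- by left; exists t' => //; apply: subtree_node t'k.
- by right; exists a => //; apply: subtree_node ak.
Qed.

(* [flat j k] replaces the leaves of a tree in X (.) Y by trees over A; the
   coherence laws below are checked after flattening to trees. *)
Definition copair (X Y A : Type) (j : X -> A) (k : Y -> A) (u : X + Y) : A :=
  match u with inl x => j x | inr y => k y end.

Definition flat (X Y A : Type) (j : X -> tree A) (k : Y -> tree A)
  (t : odot X Y) : tree A := tbind (copair j k) (sval t).

(* avoiding set0 means that there is a leaf above each vertex *)
Definition scoped (X A : Type) (P : set A) (j : X -> tree A) : Prop :=
  (forall x, labelled P (j x)) /\ (forall x, avoids set0 (j x)).

Definition disj (A : Type) (P Q : set A) := forall a, P a -> Q a -> False.

Lemma avoids0 (A : Type) (t : tree A) : avoids set0 t -> ~ labelled set0 t.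
Proof. by move=> At L; have [a e] := At t (subtree_refl _) L; rewrite e in L. Qed.

Lemma scoped_leaf (X A : Type) (P : set A) (i : X -> A) :
  (forall x, P (i x)) -> scoped P (fun x => Leaf (i x)).
Proof. by move=> Pi; split=> // x; apply: avoids_leaf. Qed.

Lemma labelled_flatl (X Y A : Type) (P Q K : set A) (j : X -> tree A)
    (k : Y -> tree A) (t : tree (X + Y)) :
  scoped Q k -> disj P Q -> (forall a, K a -> P a) ->
  labelled K (tbind (copair j k) t) -> labelled (range inl) t.
Proof.
move=> [kQ k0] PQ KP; elim: t => [[x|y] H|t IH] /=.
- by exists x.
- case: (avoids0 (k0 y)); apply: labelled_mono (labelledI H (kQ y)) => a [/KP].
  exact: PQ.
- by move=> H b; apply: IH.
Qed.

Lemma labelled_flatr (X Y A : Type) (P Q K : set A) (j : X -> tree A)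
    (k : Y -> tree A) (t : tree (X + Y)) :
  scoped P j -> disj P Q -> (forall a, K a -> Q a) ->
  labelled K (tbind (copair j k) t) -> labelled (range inr) t.
Proof.
move=> [jP j0] PQ KQ; elim: t => [[x|y] H|t IH] /=.
- case: (avoids0 (j0 x)); apply: labelled_mono (labelledI H (jP x)) => a.
  by case=> /KQ qa pa; apply: PQ pa qa.
- by exists y.
- by move=> H b; apply: IH.
Qed.

Lemma labelled_sub (A : Type) (P : set A) s t :
  subtree s t -> labelled P t -> labelled P s.
Proof. by elim=> // {}s k b _ IH /= H; apply: IH. Qed.

Lemma flat_avoidsl (X Y A : Type) (P Q K : set A) (j : X -> tree A)
    (k : Y -> tree A) (t : odot X Y) :
  scoped Q k -> disj P Q -> (forall a, K a -> P a) ->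
  (forall x, avoids K (j x)) -> avoids K (flat j k t).
Proof.
case: t => t [tl tr] ek PQ KP jK s; rewrite /flat /=.
case/subtree_bind => [[t' t't ->]|[[x|y] at_ sa]] L.
- have L' := labelled_flatl ek PQ KP L.
  have [c ec] := tl _ t't L'; subst t'; have [x _ ex] := L'; subst c.
  exact: jK (subtree_refl _) L.
- exact: jK sa L.
- case: ek => kQ k0; apply: (k0 y _ sa).
  apply: labelled_mono (labelledI L (labelled_sub sa (kQ y))) => a [/KP].
  exact: PQ.
Qed.

Lemma flat_avoidsr (X Y A : Type) (P Q K : set A) (j : X -> tree A)
    (k : Y -> tree A) (t : odot X Y) :
  scoped P j -> disj P Q -> (forall a, K a -> Q a) ->
  (forall y, avoids K (k y)) -> avoids K (flat j k t).
Proof.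
case: t => t [tl tr] ek PQ KQ kK s; rewrite /flat /=.
case/subtree_bind => [[t' t't ->]|[[x|y] at_ sa]] L.
- have L' := labelled_flatr ek PQ KQ L.
  have [c ec] := tr _ t't L'; subst t'; have [x _ ex] := L'; subst c.
  exact: kK (subtree_refl _) L.
- case: ek => jP j0; apply: (j0 x _ sa).
  apply: labelled_mono (labelledI L (labelled_sub sa (jP x))) => a [/KQ].
  by move=> qa pa; apply: PQ pa qa.
- exact: kK sa L.
Qed.

Lemma flat_labelled (X Y A : Type) (P Q R : set A) (j : X -> tree A)
    (k : Y -> tree A) t :
  scoped P j -> scoped Q k -> (forall a, P a -> R a) -> (forall a, Q a -> R a) ->
  labelled R (tbind (copair j k) t).
Proof.
move=> [jP _] [kQ _] PR QR; elim: t => [[x|y]|f IH] //=.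
- exact: labelled_mono (jP x).
- exact: labelled_mono (kQ y).
Qed.

Lemma flat_inj (X Y A : Type) (P Q : set A) (j : X -> tree A) (k : Y -> tree A) :
  injective j -> injective k -> scoped P j -> scoped Q k -> disj P Q ->
  injective (flat j k).
Proof.
move=> jI kI ej ek PQ; have [jP j0] := ej; have [kQ k0] := ek.
move=> [s [sl sr]] [t [tl tr]]; rewrite /flat /= => e; apply: odot_eq => /=.
have key a y : copair j k a = tbind (copair j k) y ->
    avoids (range inl) y -> avoids (range inr) y -> Leaf a = y.
  move=> + yl yr; case: a => [a|a] /= ea.
  - have L : labelled (range inl) y.
      by apply: (labelled_flatl (j := j) ek PQ (K := P)) => //; rewrite -ea.
    case: (yl _ (subtree_refl _) L) => c yc; rewrite {}yc in ea L *.
    by case: L => c' _ ec; rewrite -{}ec /= in ea *; rewrite (jI _ _ ea).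
  - have L : labelled (range inr) y.
      by apply: (labelled_flatr (k := k) ej PQ (K := Q)) => //; rewrite -ea.
    case: (yr _ (subtree_refl _) L) => c yc; rewrite {}yc in ea L *.
    by case: L => c' _ ec; rewrite -{}ec /= in ea *; rewrite (kI _ _ ea).
elim: s t sl sr tl tr e => [a|f IH] t sl sr tl tr e; first exact: key.
case: t tl tr e => [a|g] tl tr e; first by apply/esym/key.
case: e => e; congr Node; apply: funext => b; apply: IH.
1-4: exact: avoids_child.
exact: (congr1 (fun h => h b) e).
Qed.

Lemma flat_scoped (X Y A : Type) (P Q R : set A) (j : X -> tree A)
    (k : Y -> tree A) :
  scoped P j -> scoped Q k -> disj P Q ->
  (forall a, P a -> R a) -> (forall a, Q a -> R a) -> scoped R (flat j k).
Proof.
move=> ej ek PQ PR QR; split=> t; first exact: flat_labelled PR QR.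
by apply: (flat_avoidsl (P := P) (Q := Q)) => //; case: ej.
Qed.

Lemma flat_onto (X Y A : Type) (P Q : set A) (j : X -> tree A)
    (k : Y -> tree A) (t : tree A) :
  scoped P j -> scoped Q k -> labelled (fun a => P a \/ Q a) t ->
  (forall s, subtree s t -> labelled P s -> exists x, j x = s) ->
  (forall s, subtree s t -> labelled Q s -> exists y, k y = s) ->
  exists t', flat j k t' = t.
Proof.
move=> ej ek; elim: t => [a|f IH] cov tP tQ.
  case: cov => [/(tP _ (subtree_refl _))|/(tQ _ (subtree_refl _))] [x e].
  - by exists (Odot (@avoids_leaf _ _ (inl x)) (@avoids_leaf _ _ (inl x))).
  - by exists (Odot (@avoids_leaf _ _ (inr x)) (@avoids_leaf _ _ (inr x))).
case: (EM (labelled P (Node f))) => [/(tP _ (subtree_refl _)) [x e]|nP].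
  by exists (Odot (@avoids_leaf _ _ (inl x)) (@avoids_leaf _ _ (inl x))).
case: (EM (labelled Q (Node f))) => [/(tQ _ (subtree_refl _)) [x e]|nQ].
  by exists (Odot (@avoids_leaf _ _ (inr x)) (@avoids_leaf _ _ (inr x))).
have {}IH b : exists t', flat j k t' = f b.
  apply: IH => [|s sf|s sf]; first exact: cov; [apply: tP | apply: tQ];
    exact: subtree_trans sf (subtree_node (subtree_refl _)).
have [g gP] := choice IH.
have e : tbind (copair j k) (Node (fun b => sval (g b))) = Node f.
  by rewrite /=; congr Node; apply: funext.
have al : avoids (range inl) (Node (fun b => sval (g b))).
  apply: avoids_node => [b|H]; first by case: (svalP (g b)).
  apply: nP; rewrite -e; apply/labelled_bind; apply: labelled_mono H.
  by move=> _ [x _ <-] /=; apply: ej.1.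
have ar : avoids (range inr) (Node (fun b => sval (g b))).
  apply: avoids_node => [b|H]; first by case: (svalP (g b)).
  apply: nQ; rewrite -e; apply/labelled_bind; apply: labelled_mono H.
  by move=> _ [x _ <-] /=; apply: ek.1.
by exists (Odot al ar).
Qed.


Lemma Leaf_inj (A : Type) : injective (@Leaf A).
Proof. by move=> a b []. Qed.

Lemma leaf_onto (X A : Type) (i : X -> A) t : avoids (range i) t ->
  forall s, subtree s t -> labelled (range i) s -> exists x, Leaf (i x) = s.
Proof.
move=> At s st L; have [a e] := At s st L; subst s.
by have [x _ <-] := L; exists x.
Qed.

Lemma eq_flat (X Y A : Type) (j j' : X -> tree A) (k k' : Y -> tree A) t :
  j =1 j' -> k =1 k' -> flat j k t = flat j' k' t.
Proof. by move=> jj kk; apply: eq_tbind => -[x|y] /=. Qed.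

Lemma tbind_flat (X Y A C : Type) (h : A -> tree C) (j : X -> tree A)
    (k : Y -> tree A) t :
  tbind h (flat j k t) = flat (fun x => tbind h (j x)) (fun y => tbind h (k y)) t.
Proof. by rewrite /flat tbindA; apply: eq_tbind => -[]. Qed.

Lemma tmap_flat (X Y A : Type) (h : X + Y -> A) (t : odot X Y) :
  tmap h (sval t)
  = flat (fun x => Leaf (h (inl x))) (fun y => Leaf (h (inr y))) t.
Proof. by apply: eq_tbind => -[]. Qed.

Lemma odot_mapl (X X' Y Y' : Type) (f : X -> X') (g : Y -> Y') (t : odot X Y) :
  avoids (range inl) (tmap (copair (inl \o f) (inr \o g)) (sval t)).
Proof.
rewrite tmap_flat; apply: (flat_avoidsl (P := range inl) (Q := range inr)) => //.
- by apply: scoped_leaf => x; exists (g x).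
- by move=> a [x _ <-] [].
- by move=> x; apply: avoids_leaf.
Qed.

Lemma odot_mapr (X X' Y Y' : Type) (f : X -> X') (g : Y -> Y') (t : odot X Y) :
  avoids (range inr) (tmap (copair (inl \o f) (inr \o g)) (sval t)).
Proof.
rewrite tmap_flat; apply: (flat_avoidsr (P := range inl) (Q := range inr)) => //.
- by apply: scoped_leaf => x; exists (f x).
- by move=> a [x _ <-] [].
- by move=> x; apply: avoids_leaf.
Qed.

Definition odot_map (X X' Y Y' : Type) (f : X -> X') (g : Y -> Y')
  (t : odot X Y) : odot X' Y' := Odot (@odot_mapl _ _ _ _ f g t) (@odot_mapr _ _ _ _ f g t).

Lemma odot_symml (X Y : Type) (t : odot X Y) :
  avoids (range inl) (tmap (copair inr inl) (sval t) : tree (Y + X)).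
Proof.
rewrite tmap_flat; apply: (flat_avoidsr (P := range inr) (Q := range inl)) => //.
- by apply: scoped_leaf => x; exists x.
- by move=> a [x _ <-] [].
- by move=> x; apply: avoids_leaf.
Qed.

Lemma odot_symmr (X Y : Type) (t : odot X Y) :
  avoids (range inr) (tmap (copair inr inl) (sval t) : tree (Y + X)).
Proof.
rewrite tmap_flat; apply: (flat_avoidsl (P := range inr) (Q := range inl)) => //.
- by apply: scoped_leaf => x; exists x.
- by move=> a [x _ <-] [].
- by move=> x; apply: avoids_leaf.
Qed.

Definition odot_symm (X Y : Type) (t : odot X Y) : odot Y X :=
  Odot (@odot_symml _ _ t) (@odot_symmr _ _ t).

Definition odot_inl (X Y : Type) (x : X) : odot X Y :=
  Odot (@avoids_leaf _ _ (inl x)) (@avoids_leaf _ _ (inl x)).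

Definition odot_inr (X Y : Type) (y : Y) : odot X Y :=
  Odot (@avoids_leaf _ _ (inr y)) (@avoids_leaf _ _ (inr y)).

Section Associativity.
Variables X Y Z : Type.

Let x3 (x : X) : tree (X + Y + Z) := Leaf (inl (inl x)).
Let y3 (y : Y) : tree (X + Y + Z) := Leaf (inl (inr y)).
Let z3 (z : Z) : tree (X + Y + Z) := Leaf (inr z).
Let xR : set (X + Y + Z) := range (inl \o inl).
Let yR : set (X + Y + Z) := range (inl \o inr).
Let zR : set (X + Y + Z) := range inr.
Let xyR : set (X + Y + Z) := fun a => xR a \/ yR a.
Let yzR : set (X + Y + Z) := fun a => yR a \/ zR a.

Let x3P : scoped xR x3. Proof. by apply: scoped_leaf => x; exists x. Qed.
Let y3P : scoped yR y3. Proof. by apply: scoped_leaf => x; exists x. Qed.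
Let z3P : scoped zR z3. Proof. by apply: scoped_leaf => x; exists x. Qed.
Let x3I : injective x3. Proof. by move=> x y []. Qed.
Let y3I : injective y3. Proof. by move=> x y []. Qed.
Let z3I : injective z3. Proof. by move=> x y []. Qed.
Let xyD : disj xR yR. Proof. by move=> a [x _ <-] []. Qed.
Let xzD : disj xR zR. Proof. by move=> a [x _ <-] []. Qed.
Let yzD : disj yR zR. Proof. by move=> a [x _ <-] []. Qed.
Let xy_zD : disj xyR zR. Proof. by move=> a [/xzD|/yzD]. Qed.
Let x_yzD : disj xR yzR. Proof. by move=> a /[dup] /xyD + /xzD + [] => h1 h2. Qed.
Let xyP : scoped xyR (flat x3 y3).
Proof. by apply: flat_scoped x3P y3P xyD _ _ => a ?; [left | right]. Qed.
Let yzP : scoped yzR (flat y3 z3).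
Proof. by apply: flat_scoped y3P z3P yzD _ _ => a ?; [left | right]. Qed.
Let cover (t : tree (X + Y + Z)) : labelled (fun a => [\/ xR a, yR a | zR a]) t.
Proof.
elim: t => [[[x|y]|z]|k IH] //=.
- by constructor 1; exists x.
- by constructor 2; exists y.
- by constructor 3; exists z.
Qed.

(* grafting at the leaves labelled in X (.) Y *)
Definition graftl (t : odot (odot X Y) Z) : tree (X + Y + Z) :=
  tbind (copair (fun s => tmap inl (sval s)) (fun z => Leaf (inr z))) (sval t).

(* grafting at the leaves labelled in Y (.) Z *)
Definition graftr (t : odot X (odot Y Z)) : tree (X + Y + Z) :=
  tbind (copair (fun x => Leaf (inl (inl x)))
    (fun s => tmap (copair (inl \o inr) inr) (sval s))) (sval t).

Lemma graftl_flat t : graftl t = flat (flat x3 y3) z3 t.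
Proof. by apply: eq_flat => // s; rewrite tmap_flat. Qed.

Lemma graftr_flat t : graftr t = flat x3 (flat y3 z3) t.
Proof. by apply: eq_flat => // s; rewrite tmap_flat. Qed.

Lemma graftl1 t : avoids (range (inl \o inl)) (graftl t).
Proof.
rewrite graftl_flat; apply: (flat_avoidsl z3P xy_zD) => [a|s]; first by left.
by apply: (flat_avoidsl y3P xyD) => // x; apply: avoids_leaf.
Qed.

Lemma graftl2 t : avoids (range (inl \o inr)) (graftl t).
Proof.
rewrite graftl_flat; apply: (flat_avoidsl z3P xy_zD) => [a|s]; first by right.
by apply: (flat_avoidsr x3P xyD) => // x; apply: avoids_leaf.
Qed.

Lemma graftl3 t : avoids (range inr) (graftl t).
Proof.
rewrite graftl_flat; apply: (flat_avoidsr xyP xy_zD) => // s.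
exact: avoids_leaf.
Qed.

Lemma graftr1 t : avoids (range (inl \o inl)) (graftr t).
Proof.
rewrite graftr_flat; apply: (flat_avoidsl yzP x_yzD) => // s.
exact: avoids_leaf.
Qed.

Lemma graftr2 t : avoids (range (inl \o inr)) (graftr t).
Proof.
rewrite graftr_flat; apply: (flat_avoidsr x3P x_yzD) => [a|s]; first by left.
by apply: (flat_avoidsl z3P yzD) => // x; apply: avoids_leaf.
Qed.

Lemma graftr3 t : avoids (range inr) (graftr t).
Proof.
rewrite graftr_flat; apply: (flat_avoidsr x3P x_yzD) => [a|s]; first by right.
by apply: (flat_avoidsr y3P yzD) => // x; apply: avoids_leaf.
Qed.

Definition ell (t : odot (odot X Y) Z) : odot3 X Y Z :=
  Odot3 (@graftl1 t) (@graftl2 t) (@graftl3 t).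

Definition arr (t : odot X (odot Y Z)) : odot3 X Y Z :=
  Odot3 (@graftr1 t) (@graftr2 t) (@graftr3 t).

Lemma ell_inj : injective ell.
Proof.
move=> s t /(congr1 sval) /=; rewrite !graftl_flat.
apply: (flat_inj _ z3I xyP z3P xy_zD); exact: (flat_inj x3I y3I x3P y3P xyD).
Qed.

Lemma arr_inj : injective arr.
Proof.
move=> s t /(congr1 sval) /=; rewrite !graftr_flat.
apply: (flat_inj x3I _ x3P yzP x_yzD); exact: (flat_inj y3I z3I y3P z3P yzD).
Qed.

Lemma ell_onto (u : odot3 X Y Z) : exists t, ell t = u.
Proof.
case: u => u [u1 u2 u3].
have [t e] : exists t, flat (flat x3 y3) z3 t = u.
  apply: (flat_onto xyP z3P) => [|s su L|]; last exact: leaf_onto.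
    apply: labelled_mono (cover u) => a.
    by case=> ?; [left; left | left; right | right].
  by apply: (flat_onto x3P y3P) => //; apply: leaf_onto; apply: avoids_sub su _.
by exists t; apply: odot3_eq; rewrite /= graftl_flat.
Qed.

Lemma arr_onto (u : odot3 X Y Z) : exists t, arr t = u.
Proof.
case: u => u [u1 u2 u3].
have [t e] : exists t, flat x3 (flat y3 z3) t = u.
  apply: (flat_onto x3P yzP) => [||s su L]; [|exact: leaf_onto|].
    apply: labelled_mono (cover u) => a.
    by case=> ?; [left | right; left | right; right].
  by apply: (flat_onto y3P z3P) => //; apply: leaf_onto; apply: avoids_sub su _.
by exists t; apply: odot3_eq; rewrite /= graftr_flat.
Qed.

End Associativity.

Definition binv (X Y : Type) (f : X -> Y) (onto : forall y, exists x, f x = y)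
  (y : Y) : X := sval (cid (onto y)).

Lemma binvK (X Y : Type) (f : X -> Y) (onto : forall y, exists x, f x = y) y :
  f (binv onto y) = y.
Proof. exact: (svalP (cid (onto y))). Qed.

Lemma binvP (X Y : Type) (f : X -> Y) (onto : forall y, exists x, f x = y) x :
  injective f -> binv onto (f x) = x.
Proof. by apply; rewrite binvK. Qed.

(* The associativity constraint is the inverse of [arr] after [ell]. *)
Definition odot_assoc (X Y Z : Type) (t : odot (odot X Y) Z) :
  odot X (odot Y Z) := binv (@arr_onto X Y Z) (ell t).

Definition odot_associ (X Y Z : Type) (t : odot X (odot Y Z)) :
  odot (odot X Y) Z := binv (@ell_onto X Y Z) (arr t).

Lemma odot_inl_onto (X : Type) (t : odot X void) : exists x, odot_inl _ x = t.
Proof.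
have L : labelled (range inl) (sval t).
  by elim: (sval t) => [[x|[]]|k IH] //=; exists x.
have [a e] := (svalP t).1 _ (subtree_refl _) L.
by rewrite e in L; have [x _ ex] := L; exists x; apply: odot_eq; rewrite e -ex.
Qed.

Lemma odot_inr_onto (X : Type) (t : odot void X) : exists x, odot_inr _ x = t.
Proof.
have L : labelled (range inr) (sval t).
  by elim: (sval t) => [[[]|x]|k IH] //=; exists x.
have [a e] := (svalP t).2 _ (subtree_refl _) L.
by rewrite e in L; have [x _ ex] := L; exists x; apply: odot_eq; rewrite e -ex.
Qed.

Lemma odot_inl_inj (X Y : Type) : injective (@odot_inl X Y).
Proof. by move=> x y []. Qed.

Lemma odot_inr_inj (X Y : Type) : injective (@odot_inr X Y).
Proof. by move=> x y []. Qed.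

Definition odot_runit (X : Type) : odot X void -> X := binv (@odot_inl_onto X).
Definition odot_lunit (X : Type) : odot void X -> X := binv (@odot_inr_onto X).

Section Flat.
Variable A : Type.

Lemma flat_map (X X' Y Y' : Type) (f : X -> X') (g : Y -> Y')
    (j : X' -> tree A) (k : Y' -> tree A) t :
  flat j k (odot_map f g t) = flat (fun x => j (f x)) (fun y => k (g y)) t.
Proof. by rewrite {1}/flat /= /tmap tbindA; apply: eq_tbind => -[]. Qed.

Lemma flat_symm (X Y : Type) (j : X -> tree A) (k : Y -> tree A) t :
  flat k j (odot_symm t) = flat j k t.
Proof. by rewrite {1}/flat /= /tmap tbindA; apply: eq_tbind => -[]. Qed.

Lemma flat_runit (X : Type) (j : X -> tree A) (k : void -> tree A) t :
  flat j k t = j (odot_runit t).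
Proof. by rewrite -{1}[t](binvK (@odot_inl_onto X)). Qed.

Lemma flat_lunit (X : Type) (j : void -> tree A) (k : X -> tree A) t :
  flat j k t = k (odot_lunit t).
Proof. by rewrite -{1}[t](binvK (@odot_inr_onto X)). Qed.

Lemma flat_ell (X Y Z : Type) (j : X -> tree A) (k : Y -> tree A)
    (l : Z -> tree A) t :
  tbind (copair (copair j k) l) (sval (ell t)) = flat (flat j k) l t.
Proof.
rewrite /= graftl_flat tbind_flat; apply: eq_flat => // s.
by rewrite tbind_flat; apply: eq_flat.
Qed.

Lemma flat_arr (X Y Z : Type) (j : X -> tree A) (k : Y -> tree A)
    (l : Z -> tree A) t :
  tbind (copair (copair j k) l) (sval (arr t)) = flat j (flat k l) t.
Proof.
rewrite /= graftr_flat tbind_flat; apply: eq_flat => // s.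
by rewrite tbind_flat; apply: eq_flat.
Qed.

Lemma flat_assoc (X Y Z : Type) (j : X -> tree A) (k : Y -> tree A)
    (l : Z -> tree A) t :
  flat j (flat k l) (odot_assoc t) = flat (flat j k) l t.
Proof. by rewrite -flat_arr binvK flat_ell. Qed.

End Flat.

Lemma faith2 (X Y : Type) (s t : odot X Y) :
  (forall A (j : X -> tree A) (k : Y -> tree A), flat j k s = flat j k t) ->
  s = t.
Proof.
move=> /(_ _ (fun x => Leaf (inl x)) (fun y => Leaf (inr y))) e; apply: odot_eq.
rewrite -[LHS]tbind_leaf -[RHS]tbind_leaf; move: e; rewrite /flat.
by have -> : copair (fun x : X => Leaf (inl x)) (fun y : Y => Leaf (inr y))
  = @Leaf _ by apply: funext => -[].
Qed.

Lemma faith3 (X Y Z : Type) (s t : odot X (odot Y Z)) :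
  (forall A (j : X -> tree A) (k : Y -> tree A) (l : Z -> tree A),
    flat j (flat k l) s = flat j (flat k l) t) -> s = t.
Proof.
move=> e; apply: arr_inj; apply: odot3_eq; rewrite /= !graftr_flat; exact: e.
Qed.

Lemma faith4 (W X Y Z : Type) (s t : odot W (odot X (odot Y Z))) :
  (forall A (i : W -> tree A) (j : X -> tree A) (k : Y -> tree A)
     (l : Z -> tree A),
    flat i (flat j (flat k l)) s = flat i (flat j (flat k l)) t) -> s = t.
Proof.
move=> e.
pose yi := inr \o (inr \o inl) : Y -> W + (X + (Y + Z)).
pose zi := inr \o (inr \o inr) : Z -> W + (X + (Y + Z)).
pose xi := inr \o inl : X -> W + (X + (Y + Z)).
pose wi := inl : W -> W + (X + (Y + Z)).
have xP : scoped (range xi) (fun x => Leaf (xi x)).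
  by apply: scoped_leaf => x; exists x.
have yP : scoped (range yi) (fun x => Leaf (yi x)).
  by apply: scoped_leaf => x; exists x.
have zP : scoped (range zi) (fun x => Leaf (zi x)).
  by apply: scoped_leaf => x; exists x.
have wP : scoped (range wi) (fun x => Leaf (wi x)).
  by apply: scoped_leaf => x; exists x.
have yz : disj (range yi) (range zi) by move=> a [x _ <-] [].
have x_yz : disj (range xi) (range (inr \o inr)) by move=> a [x _ <-] [].
have w_xyz : disj (range wi) (range inr) by move=> a [x _ <-] [].
have yzP : scoped (range (inr \o inr))
    (flat (fun x => Leaf (yi x)) (fun x => Leaf (zi x))).
  by apply: flat_scoped yP zP yz _ _ => a [x _ <-];
    [exists (inl x) | exists (inr x)].
have xyzP : scoped (range inr) (flat (fun x => Leaf (xi x))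
    (flat (fun x => Leaf (yi x)) (fun x => Leaf (zi x)))).
  by apply: flat_scoped xP yzP x_yz _ _ => a [x _ <-];
    [exists (inl x) | exists (inr x)].
apply: (flat_inj _ _ wP xyzP w_xyz); last exact: e; first by move=> x y [].
apply: (flat_inj _ _ xP yzP x_yz); first by move=> x y [].
by apply: (flat_inj _ _ yP zP yz) => x y [].
Qed.


Definition odot_symmon : symmon.
Proof.
apply: (@SymMon set_cat odot odot_map void odot_assoc odot_associ odot_lunit
  (fun X => @odot_inr void X) odot_runit (fun X => @odot_inl X void)
  odot_symm) => /=.
- move=> X Y; apply: funext => t; apply: faith2 => A j k.
  by rewrite flat_map.
- move=> X X' X'' Y Y' Y'' f' f g' g; apply: funext => t.
  by apply: faith2 => A j k; rewrite !flat_map.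
- move=> X Y Z; apply: funext => t; apply: ell_inj.
  by rewrite binvK /odot_assoc binvK.
- move=> X Y Z; apply: funext => t; apply: arr_inj.
  by rewrite binvK /odot_associ binvK.
- by move=> X; apply: funext => t; apply: binvK.
- by move=> X; apply: funext => t; apply: binvP; apply: odot_inr_inj.
- by move=> X; apply: funext => t; apply: binvK.
- by move=> X; apply: funext => t; apply: binvP; apply: odot_inl_inj.
- move=> X Y; apply: funext => t; apply: faith2 => A j k.
  by rewrite !flat_symm.
- move=> X X' Y Y' Z Z' f g h; apply: funext => t; apply: faith3 => A j k l.
  rewrite flat_assoc !flat_map; under [in RHS]eq_flat do [|rewrite flat_map].
  by rewrite flat_assoc; apply: eq_flat => // s; rewrite flat_map.
- move=> X X' f; apply: funext => t; apply: Leaf_inj.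
  by rewrite -(flat_lunit (fun e => match e with end)) flat_map flat_lunit.
- move=> X X' f; apply: funext => t; apply: Leaf_inj.
  by rewrite -(flat_runit _ (fun e => match e with end)) flat_map flat_runit.
- move=> X X' Y Y' f g; apply: funext => t; apply: faith2 => A j k.
  by rewrite flat_symm !flat_map flat_symm.
- move=> X Y; apply: funext => t; apply: faith2 => A j k.
  rewrite !flat_map; pose v (e : void) : tree A := match e with end.
  transitivity (flat j (flat v k) (odot_assoc t)).
    by apply: eq_flat => // s; rewrite flat_lunit.
  by rewrite flat_assoc; apply: eq_flat => // s; rewrite flat_runit.
- move=> W X Y Z; apply: funext => t; apply: faith4 => A i j k l.
  rewrite !flat_assoc flat_map.
  transitivity (flat i (flat (flat j k) l)
    (odot_assoc (odot_map (@odot_assoc W X Y) id t))).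
    by apply: eq_flat => // s; rewrite flat_assoc.
  by rewrite flat_assoc flat_map; apply: eq_flat => // s; rewrite flat_assoc.
- move=> X Y Z; apply: funext => t; apply: faith3 => A j k l.
  rewrite flat_assoc flat_symm flat_assoc flat_map.
  transitivity (flat j (flat l k) (odot_assoc (odot_map (@odot_symm X Y) id t))).
    by rewrite flat_assoc flat_map; apply: eq_flat => // s; rewrite flat_symm.
  by apply: eq_flat => // s; rewrite flat_symm.
Defined.

End Trees.

(* Main.v *)
Require Import Defs.
From mathcomp Require Import all_boot.
From mathcomp Require Import boolp classical_sets.

(** Flattening gives a bijection between [TX (.) TY] and [T(X + Y)], a
coproduct of free magmas being free.  The opmonoidal structure is
[T(X (.) Y) -> TT(X + Y) -> T(X + Y) ~ TX (.) TY], with the multiplication of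
[T] in the middle, and its coherence laws can be checked after flattening.  For
magmas X and Y, every element of [X (.) Y] is the value of its own underlying
tree in the lifted structure, so homomorphisms [f] and [g] out of X and Y extend
uniquely to [X (.) Y]: relabel along [f] and [g], then evaluate. *)

Set Implicit Arguments.
Unset Strict Implicit.
Unset Printing Implicit Defensive.

Section Magma.
Variables (B : Type) (b0 : B).
Local Notation tree := (tree B).
Local Notation odot := (odot B).

(** * Leaves and relabelling of trees *)

(** Following the branch [b0] upwards always ends at a leaf. Without branches, a [Node] would be a
    tree with no leaves. *)
Lemma labelled_set0 (A : Type) (t : tree A) : ~ labelled set0 t.
Proof. by elim: t => [a|k IH] //= /(_ b0) /IH. Qed.

Lemma scoped_labelled (X A : Type) (P : set A) (j : X -> tree A) :
  (forall x, labelled P (j x)) -> scoped P j.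
Proof. by move=> jP; split=> // x s _ /labelled_set0. Qed.

Lemma labelled_tmap (A C : Type) (f : A -> C) (t : tree A) :
  labelled (range f) (tmap f t).
Proof. by elim: t => [a|k IH] //=; exists a. Qed.

Lemma scoped_tmap (A C : Type) (f : A -> C) : scoped (range f) (@tmap B A C f).
Proof. by apply: scoped_labelled => t; apply: labelled_tmap. Qed.

Lemma tmap_inj (A C : Type) (f : A -> C) :
  injective f -> injective (@tmap B A C f).
Proof.
move=> fI; elim=> [a|k IH] [a'|k'] //= [].
- by move/fI->.
- move=> e; congr Node; apply: funext => b; apply: IH.
  exact: (congr1 (fun h => h b) e).
Qed.

Lemma tmap_onto (A C : Type) (f : A -> C) (t : tree C) :
  labelled (range f) t -> exists s, tmap f s = t.
Proof.
elim: t => [c [a _ <-]|k IH /= L]; first by exists (Leaf B a).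
have [g gP] := choice (fun b => IH b (L b)).
by exists (Node g); rewrite /tmap /=; congr Node; apply: funext => b; apply: gP.
Qed.

(** * The bijection from [TX (.) TY] to [T(X + Y)] *)

Definition odot_merge (X Y : Type) : odot (tree X) (tree Y) -> tree (X + Y) :=
  flat (tmap inl) (tmap inr).

Lemma odot_merge_inj (X Y : Type) : injective (@odot_merge X Y).
Proof.
apply: flat_inj (scoped_tmap _) (scoped_tmap _) _.
- by apply: tmap_inj => x y [].
- by apply: tmap_inj => x y [].
- by move=> a [x _ <-] [].
Qed.

(** The maximal subtrees with labels from one side only are cut off and become the leaf labels. *)
Lemma odot_merge_onto (X Y : Type) (t : tree (X + Y)) : exists s, odot_merge s = t.
Proof.
apply: flat_onto (scoped_tmap _) (scoped_tmap _) _ _ _.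
- by elim: t => [[x|y]|k IH] //=; [left; exists x | right; exists y].
- by move=> s _; apply: tmap_onto.
- by move=> s _; apply: tmap_onto.
Qed.

Lemma tbind_tmap (A C D : Type) (g : C -> tree D) (f : A -> C) (t : tree A) :
  tbind g (tmap f t) = tbind (fun a => g (f a)) t.
Proof. by rewrite /tmap tbindA. Qed.

Lemma tbind_odot_merge (X Y A : Type) (j : X -> tree A) (k : Y -> tree A)
    (s : odot (tree X) (tree Y)) :
  tbind (copair j k) (odot_merge s) = flat (tbind j) (tbind k) s.
Proof. by rewrite tbind_flat; apply: eq_flat => t; rewrite tbind_tmap. Qed.

(** For [j] and [k] the injections followed by [Leaf], the hypothesis equates the two merged
    trees. *)
Lemma odot_merge_faithful (X Y : Type) (s t : odot (tree X) (tree Y)) :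
  (forall A (j : X -> tree A) (k : Y -> tree A),
    flat (tbind j) (tbind k) s = flat (tbind j) (tbind k) t) -> s = t.
Proof. by move=> e; apply: odot_merge_inj; apply: e. Qed.

Lemma odot_merge_faithful3 (X Y Z : Type)
    (s t : odot (tree X) (odot (tree Y) (tree Z))) :
  (forall A (i : X -> tree A) (j : Y -> tree A) (k : Z -> tree A),
    flat (tbind i) (flat (tbind j) (tbind k)) s
    = flat (tbind i) (flat (tbind j) (tbind k)) t) -> s = t.
Proof.
pose xi : X -> X + (Y + Z) := inl.
pose yi : Y -> X + (Y + Z) := inr \o inl.
pose zi : Z -> X + (Y + Z) := inr \o inr.
move=> e; apply: (flat_inj _ _ (scoped_tmap xi) (Q := range inr)
  (k := flat (tmap yi) (tmap zi))); last exact: e.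
- by apply: tmap_inj => x y [].
- apply: flat_inj (scoped_tmap _) (scoped_tmap _) _.
  + by apply: tmap_inj => x y [].
  + by apply: tmap_inj => x y [].
  + by move=> a [x _ <-] [].
- apply: flat_scoped (scoped_tmap _) (scoped_tmap _) _ _ _ => a [x _ <-].
  + by case.
  + by exists (inl x).
  + by exists (inr x).
- by move=> a [x _ <-] [].
Qed.

(** * The opmonoidal structure *)

Definition odot_ups (X Y : Type) (t : tree (odot X Y)) : odot (tree X) (tree Y) :=
  binv (@odot_merge_onto X Y) (tbind sval t).

(** By faithfulness this equation characterises [odot_ups]; the coherence laws are derived from
    it. *)
Lemma flat_ups (X Y A : Type) (j : X -> tree A) (k : Y -> tree A)
    (t : tree (odot X Y)) :
  flat (tbind j) (tbind k) (odot_ups t) = tbind (flat j k) t.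
Proof. by rewrite -tbind_odot_merge binvK tbindA. Qed.

Fixpoint tree_void (t : tree void) : void :=
  match t with Leaf a => a | Node k => tree_void (k b0) end.

Definition odot_symopmon : symopmon (odot_symmon B) (magma_monad B).
Proof.
apply: (@SymOpmon (odot_symmon B) (magma_monad B) tree_void odot_ups) => /=.
- move=> X X' Y Y' f g; apply: funext => t; apply: odot_merge_faithful => A j k.
  rewrite flat_ups flat_map tbind_tmap.
  transitivity (flat (tbind (j \o f)) (tbind (k \o g)) (odot_ups t)).
    by rewrite flat_ups; apply: eq_tbind => s; rewrite flat_map.
  by apply: eq_flat => s; rewrite tbind_tmap.
- move=> X Y Z; apply: funext => t; apply: odot_merge_faithful3 => A i j k.
  rewrite flat_assoc !flat_map.
  (* Both sides flatten to this substitution into [t]. *)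
  transitivity (tbind (flat (flat i j) k) t).
    rewrite -flat_ups; apply: eq_flat => // s; exact: flat_ups.
  transitivity (flat (tbind i) (tbind (flat j k))
    (odot_ups (tmap (@odot_assoc B X Y Z) t))).
    by rewrite flat_ups tbind_tmap; apply: eq_tbind => s; rewrite flat_assoc.
  by apply: eq_flat => // s; rewrite flat_ups.
- move=> X; apply: funext => t.
  pose v (e : void) : tree X := match e with end.
  rewrite -[LHS]tbind_leaf -(flat_lunit v) flat_map.
  transitivity (flat (tbind v) (tbind (@Leaf B X)) (odot_ups t)).
    (* A tree labelled in [void] yields an element of [void], so all functions on such trees
       agree. *)
    by apply: eq_flat => // s; case: (tree_void s).
  by rewrite flat_ups; apply: eq_tbind => s; rewrite flat_lunit.
- move=> X; apply: funext => t.
  pose v (e : void) : tree X := match e with end.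
  rewrite -[LHS]tbind_leaf -(flat_runit _ v) flat_map.
  transitivity (flat (tbind (@Leaf B X)) (tbind v) (odot_ups t)).
    by apply: eq_flat => // s; case: (tree_void s).
  by rewrite flat_ups; apply: eq_tbind => s; rewrite flat_runit.
- move=> X Y; apply: funext => t; apply: odot_merge_faithful => A j k.
  by rewrite flat_symm !flat_ups tbind_tmap; apply: eq_tbind => s;
    rewrite flat_symm.
- move=> X Y; apply: funext => t; apply: odot_merge_faithful => A j k.
  by rewrite flat_ups flat_map.
- move=> X Y; apply: funext => t; apply: odot_merge_faithful => A j k.
  rewrite flat_ups flat_map tbindA.
  (* Substituting after the multiplication is substituting at two levels, so [flat_ups] applies with
     [tbind j] and [tbind k]. *)
  transitivity (flat (tbind (tbind j)) (tbind (tbind k))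
    (odot_ups (tmap (@odot_ups X Y) t))).
    by rewrite flat_ups tbind_tmap; apply: eq_tbind => s; rewrite flat_ups.
  by apply: eq_flat => s; rewrite tbindA.
- by apply: funext.
- by apply: funext => t; case: (tree_void _).
Defined.

(** * The initial algebra and binary coproducts *)

Let em := em_symmon odot_symopmon.

Definition magma_initial : initial (tunit : em).
Proof.
have bang (X : em) : hom (tunit : em) X.
  exists (fun v : void => match v with end).
  by apply: funext => t; case: (tree_void t).
by exists bang => X f; apply: alg_hom_eq; apply: funext => -[].
Defined.

Lemma aact_tmap_aact (W : algebra (magma_monad B)) (t : tree (tree (acar W))) :
  aact W (tmap (aact W) t) = aact W (tbind id t).
Proof. by have /(congr1 (fun h => h t)) /= := aact_mul W. Qed.

Lemma aact_leaf (W : algebra (magma_monad B)) (w : acar W) :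
  aact W (Leaf B w) = w.
Proof. by have /(congr1 (fun h => h w)) /= := aact_unit W. Qed.

Lemma amap_aact (V W : algebra (magma_monad B)) (f : alg_hom V W)
    (t : tree (acar V)) :
  amap f (aact V t) = aact W (tmap (amap f) t).
Proof. by have /(congr1 (fun h => h t)) /= := amapP f. Qed.

Lemma odot_map_map (X X' X'' Y Y' Y'' : Type) (f' : X' -> X'') (f : X -> X')
    (g' : Y' -> Y'') (g : Y -> Y') (t : odot X Y) :
  odot_map f' g' (odot_map f g t) = odot_map (f' \o f) (g' \o g) t.
Proof. by apply: faith2 => A j k; rewrite !flat_map. Qed.

Lemma odot_map_id (X Y : Type) (f : X -> X) (g : Y -> Y) (t : odot X Y) :
  f =1 id -> g =1 id -> odot_map f g t = t.
Proof.
by move=> fE gE; apply: faith2 => A j k; rewrite flat_map;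
  apply: eq_flat => x; rewrite ?fE ?gE.
Qed.

Lemma odot_ups_sval (X Y : Type) (t : odot X Y) :
  odot_ups (tmap (copair (@odot_inl B X Y) (@odot_inr B X Y)) (sval t))
  = odot_map (@Leaf B X) (@Leaf B Y) t.
Proof.
apply: odot_merge_faithful => A j k.
by rewrite flat_ups flat_map tbind_tmap; apply: eq_tbind => -[].
Qed.

(** [odot_ups] turns the labels into one-vertex trees, which the unit laws of X and Y collapse.
    Hence the copies of X and Y generate the tensor product. *)
Lemma aact_sval (X Y : algebra (magma_monad B)) (t : odot (acar X) (acar Y)) :
  aact (alg_ten odot_symopmon X Y)
    (tmap (copair (@odot_inl B _ _) (@odot_inr B _ _)) (sval t)) = t.
Proof.
rewrite /= odot_ups_sval odot_map_map.
by apply: odot_map_id => x; apply: aact_leaf.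
Qed.

Definition odot_copair (X Y W : algebra (magma_monad B)) (f : alg_hom X W)
  (g : alg_hom Y W) : alg_hom (alg_ten odot_symopmon X Y) W.
Proof.
exists (fun t => aact W (flat (fun x => Leaf B (amap f x))
  (fun y => Leaf B (amap g y)) t)).
apply: funext => s /=; rewrite flat_map.
(* As [f] and [g] are homomorphisms, the labels may be mapped to W before they are evaluated;
   associativity of the action then allows grafting first. *)
transitivity (aact W (tmap (aact W) (flat (fun x => Leaf B (tmap (amap f) x))
    (fun y => Leaf B (tmap (amap g) y)) (odot_ups s)))).
  rewrite /tmap tbind_flat; congr (aact W _).
  by apply: eq_flat => x /=; rewrite amap_aact.
rewrite aact_tmap_aact tbind_flat /=.
transitivity (aact W (tbind (flat (fun x => Leaf B (amap f x))
    (fun y => Leaf B (amap g y))) s)).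
  by rewrite -flat_ups; congr (aact W _).
by rewrite -[in LHS](tbind_tmap id) -aact_tmap_aact /tmap tbindA.
Defined.

Lemma magma_cocartesian : linear_exponential odot_symopmon.
Proof.
exists magma_initial => X Y W f g; exists (odot_copair f g); split.
  by split; apply: alg_hom_eq; apply: funext => x; rewrite /= aact_leaf.
move=> h [hf hg]; apply: alg_hom_eq; apply: funext => t /=.
(* Since [h] preserves the evaluation of trees, only its values on one-leaf trees matter. *)
rewrite -[in RHS](aact_sval t) amap_aact /tmap tbindA; congr (aact W _).
apply: eq_tbind => -[x|y] /=; congr Leaf.
- have /(congr1 (fun h : alg_hom X W => amap h x)) /= <- := hf.
  (* The coproduct injection sends [x] to a one-leaf tree, equal to [odot_inl] up to the proofs of
     avoidance. *)
  by congr (amap h _); apply: odot_eq.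
- have /(congr1 (fun h : alg_hom Y W => amap h y)) /= <- := hg.
  by congr (amap h _); apply: odot_eq.
Qed.

End Magma.

Theorem proposition61 (B : finType) (B_gt0 : 0 < #|B|) :
  exists u : symopmon (odot_symmon B) (magma_monad B), linear_exponential u.
Proof.
have /card_gt0P [b0 _] := B_gt0.
by exists (odot_symopmon b0); apply: magma_cocartesian.
Qed.
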